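(* Let $\mathcal{P}$ be a bilateral, locally decided, memoryless parking procedure. Then $\widehat{\mathcal{P}}$ is a good correspondence, i.e. for any $(P,Q)$ in the image of $\widehat{\mathcal{P}}$ and any decreasing forest $Q'$ of the same shape as $Q$, $(P,Q')$ is also in the image of $\widehat{\mathcal{P}}$. Moreover, the labeled indexed forests $P$ that occur as first components of elements of the image are exactly those satisfying the following condition: for every node $i$ (identified by its canonical label) with interval $[l_i,r_i]$, the label of $i$ in $P$ belongs to the set $$\{j\in\{l_i,\ldots,i-1\}\mid \mathrm{Dir}_{\mathcal{P}}(\{l_i,\ldots,i-1\},j)=right\}\cup\{i\}\cup\{j\in\{i+1,\ldots,r_i\}\mid \mathrm{Dir}_{\mathcal{P}}(\{i+1,\ldots,r_i\},j)=left\}.$$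
   Context: $\mathbb{Z}^*$ is the set of finite words on $\mathbb{Z}$, $\epsilon$ the empty word, $\mathrm{Fin}(\mathbb{Z})$ the set of finite subsets of $\mathbb{Z}$. A parking procedure is a function $\mathcal{P}:\mathbb{Z}^*\to\mathrm{Fin}(\mathbb{Z})$ with $\mathcal{P}(\epsilon)=\emptyset$ such that for every word $a_1\cdots a_r$ with $r\ge1$: (1) $\#\mathcal{P}(a_1\cdots a_r)=r$ and $\mathcal{P}(a_1\cdots a_i)\subset\mathcal{P}(a_1\cdots a_{i+1})$ for $i<r$; (2) if $a_r\notin\mathcal{P}(a_1\cdots a_{r-1})$ then $\mathcal{P}(a_1\cdots a_r)=\mathcal{P}(a_1\cdots a_{r-1})\sqcup\{a_r\}$. The spot where the $i$th car parks is $\mathrm{ls}_{\mathcal{P}}(a_1\cdots a_i)$, the unique element of $\mathcal{P}(a_1\cdots a_i)\setminus\mathcal{P}(a_1\cdots a_{i-1})$. A block of $S\subset\mathbb{Z}$ is a maximal nonempty interval of consecutive integers contained in $S$. $\mathcal{P}$ is bilateral if whenever $a\in\mathcal{P}(W)$ lies in the block $\{t,\ldots,u\}$ of $\mathcal{P}(W)$, $\mathrm{ls}_{\mathcal{P}}(Wa)\in\{t-1,u+1\}$; then $\mathrm{Dir}_{\mathcal{P}}(Wa)=left$ if $\mathrm{ls}_{\mathcal{P}}(Wa)=t-1$ and $right$ if it is $u+1$. $\mathcal{P}$ is memoryless if there is a function $M_{\mathcal{P}}:\mathrm{Fin}(\mathbb{Z})\times\mathbb{Z}\to\mathbb{Z}$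 such that $\mathcal{P}(Wa)=\mathcal{P}(W)\sqcup\{M_{\mathcal{P}}(\mathcal{P}(W),a)\}$ for all words $W$ and letters $a$; in that case, for $S\in\mathrm{Fin}(\mathbb{Z})$ and $a\in S$, $\mathrm{Dir}_{\mathcal{P}}(S,a)$ denotes the common value of $\mathrm{Dir}_{\mathcal{P}}(Wa)$ for all $W$ with $\mathcal{P}(W)=S$. $\mathcal{P}$ is locally decided if for every word $W$, letter $a$ and block $I$ of $\mathcal{P}(W)$ with $a\in I$, $\mathrm{ls}_{\mathcal{P}}(Wa)=\mathrm{ls}_{\mathcal{P}}(W_{|I}a)$, where $W_{|I}$ is the subword of $W$ formed by the letters of the cars that parked in $I$. The outcome function $\pi_{\mathcal{P}}(W)$ of $W=a_1\cdots a_r$ is the bijection $\mathcal{P}(W)\to\{1,\ldots,r\}$ sending an occupied spot $k$ to the index $i$ such that $\mathrm{ls}_{\mathcal{P}}(a_1\cdots a_i)=k$. A (plane) binary tree is either empty or a node with a left and a right binary subtree; its size is its number of nodes. An indexed forest is the data of a finite set $S\subset\mathbb{Z}$ (its support) and, for each block $I$ of $S$, a binary tree of size $|I|$. Its canonical labeling labels, for each block $I$, the nodes of the corresponding tree by the elements of $I$ increasingly in in-order (left subtree, root, right subtree); nodes are thereby identified with elements of $S$. The interval $[l_i,r_i]$ of a node $i$ is the interval formed by the canonical labels of all nodes of the subtree rooted at $i$ (including $i$). A decreasing forest is an indexed forest with $r$ nodes labeled bijectively by $\{1,\ldots,r\}$ so that each node has a larger label than all its descendants. Given $W=a_1\cdots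 a_r$, $\widehat{\mathcal{P}}(W)=(P,Q)$ is the pair of labeled indexed forests of the same shape defined as follows: $Q$ is the unique decreasing forest with support $\mathcal{P}(W)$ whose node with canonical label $i$ has label $q_i=\pi_{\mathcal{P}}(W)(i)$ (on each block, the root is the position of the maximum value, and the left and right subtrees are constructed recursively from the positions to the left and right of it); $P$ is the same indexed forest with node $i$ labeled by $p_i=a_{q_i}\in\mathbb{Z}$. *)

(* Defs.v *)
From HB Require Import structures.
From mathcomp Require Import all_boot all_order all_algebra finmap.

Set Implicit Arguments.
Unset Strict Implicit.
Unset Printing Implicit Defensive.

Import Order.TTheory GRing.Theory Num.Theory.

Local Open Scope fset_scope.
Local Open Scope fmap_scope.
Local Open Scope ring_scope.

(* {t, ..., u}, empty when u < t *)
Definition itv (t u : int) : {fset int} :=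
  [fset t + k%:Z | k in iota 0 (if t <= u then `|u - t|%N.+1 else 0%N)].

Lemma in_itv (t u k : int) : (k \in itv t u) = (t <= k <= u).
Proof.
apply/imfsetP/idP => [[j /=]|/andP[tk ku]].
  case: ifP => // tu; rewrite mem_iota add0n /= ltnS => ju ->.
  have ju' : (j%:Z <= u - t) by rewrite -(gez0_abs (m := u - t)) ?subr_ge0.
  by rewrite lerDl /= -lerBrDl.
exists `|k - t|%N => /=; last by rewrite gez0_abs ?subr_ge0 // addrCA subrr addr0.
rewrite (le_trans tk ku) mem_iota add0n /= ltnS -lez_nat.
by rewrite !gez0_abs ?subr_ge0 ?(le_trans tk ku) // lerD2r.
Qed.

(* Taking both endpoints in I forces I to be nonempty. *)
Definition is_interval (I : {fset int}) : bool :=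
  [exists t : I, exists u : I, I == itv (val t) (val u)].

Definition is_block (S I : {fset int}) : bool :=
  [&& is_interval I, I `<=` S &
    [forall J : fpowerset S, is_interval (val J) && (I `<=` val J) ==> (val J == I)]].

Definition blocks (S : {fset int}) : {fset {fset int}} :=
  [fset I in fpowerset S | is_block S I].

Definition elts (I : {fset int}) : seq int := sort <=%R I.

Record parking_procedure := ParkingProcedure {
  park :> seq int -> {fset int};
  park_nil : park [::] = fset0;
  card_park : forall W, #|` park W| = size W;
  park_sub : forall W a, park W `<=` park (rcons W a);
  park_free : forall W a, a \notin park W -> park (rcons W a) = a |` park W
}.

(* The spot of the last car of the word Wa: the set difference is a singleton,
   so the default value 0 is never used. *)
Definition ls (P : parking_procedure) (W : seq int) (a : int) : int :=
  head 0 (enum_fset (P (rcons W a) `\` P W)).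

Definition spots (P : parking_procedure) (W : seq int) : seq int :=
  [seq ls P (take k W) (nth 0 W k) | k <- iota 0 (size W)].

Definition bilateral (P : parking_procedure) : Prop :=
  forall W a t u, itv t u \in blocks (P W) -> a \in itv t u ->
    ls P W a = t - 1 \/ ls P W a = u + 1.

Inductive direction := Left | Right.

(* Dir P W a d states Dir_P(Wa) = d. *)
Definition Dir (P : parking_procedure) (W : seq int) (a : int) (d : direction)
    : Prop :=
  exists t u, [/\ itv t u \in blocks (P W), a \in itv t u &
    ls P W a = match d with Left => t - 1 | Right => u + 1 end].

Definition memoryless (P : parking_procedure) : Prop :=
  exists M : {fset int} -> int -> int, forall W a,
    M (P W) a \notin P W /\ P (rcons W a) = P W `|` [fset M (P W) a].

(* DirS P S a d states Dir_P(S, a) = d: the value d is common to all the words W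
   such that P(W) = S, and there is such a word. *)
Definition DirS (P : parking_procedure) (S : {fset int}) (a : int)
    (d : direction) : Prop :=
  (exists W, P W = S) /\ (forall W, P W = S -> Dir P W a d).

Definition restrict (P : parking_procedure) (W : seq int) (I : {fset int})
    : seq int :=
  mask [seq s \in I | s <- spots P W] W.

Definition locally_decided (P : parking_procedure) : Prop :=
  forall W a I, I \in blocks (P W) -> a \in I ->
    ls P W a = ls P (restrict P W I) a.

(* Indices of cars start from 1. *)
Definition outcome (P : parking_procedure) (W : seq int) (k : int) : nat :=
  (index k (spots P W)).+1.

(* The nodes are labeled in A; unlabeled binary trees are [bintree unit]. *)
Inductive bintree (A : Type) : Type :=
  | Leaf
  | Bin of bintree A & A & bintree A.
Arguments Leaf {A}.

Fixpoint inorder A (T : bintree A) : seq A :=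
  if T is Bin L x R then inorder L ++ x :: inorder R else [::].

Definition tsize A (T : bintree A) : nat := size (inorder T).

Fixpoint map_tree A B (f : A -> B) (T : bintree A) : bintree B :=
  if T is Bin L x R then Bin (map_tree f L) (f x) (map_tree f R) else Leaf.

Lemma inorder_map_tree A B (f : A -> B) (T : bintree A) :
  inorder (map_tree f T) = map f (inorder T).
Proof. by elim: T => //= L -> x R ->; rewrite map_cat. Qed.

Fixpoint decreasing_tree (T : bintree nat) : bool :=
  if T is Bin L x R then
    [&& all (fun y => y < x)%N (inorder L ++ inorder R),
        decreasing_tree L & decreasing_tree R]
  else true.

(* [subtree U T]: U is the (nonempty) subtree of T rooted at some node of T. *)
Fixpoint subtree A (U T : bintree A) : Prop :=
  if T is Bin L x R then [\/ U = T, subtree U L | subtree U R] else False.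

(* Adds to each node its canonical label, the nodes being labeled in in-order
   by the successive elements of s. *)
Fixpoint canon A (s : seq int) (T : bintree A) : bintree (int * A) :=
  if T is Bin L x R then
    Bin (canon (take (tsize L) s) L) (nth 0 s (tsize L), x)
        (canon (drop (tsize L).+1 s) R)
  else Leaf.

(* The decreasing tree of a sequence of distinct numbers; n bounds the recursion
   depth. *)
Fixpoint dectree_rec (n : nat) (s : seq nat) : bintree nat :=
  match n, s with
  | n'.+1, _ :: _ =>
    let m := (\max_(x <- s) x)%N in
    let k := index m s in
    Bin (dectree_rec n' (take k s)) m (dectree_rec n' (drop k.+1 s))
  | _, _ => Leaf
  end.

Definition dectree (s : seq nat) : bintree nat := dectree_rec (size s) s.

Lemma mem_bigmax (s : seq nat) : s != [::] -> (\max_(x <- s) x)%N \in s.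
Proof.
elim: s => // a s IHs _; rewrite big_cons.
case: (altP (s =P [::])) => [->|/IHs ms]; first by rewrite big_nil maxn0 mem_head.
by rewrite inE; case: leqP => _; rewrite ?ms ?eqxx ?orbT.
Qed.

Lemma inorder_dectree_rec (n : nat) (s : seq nat) :
  (size s <= n)%N -> inorder (dectree_rec n s) = s.
Proof.
elim: n s => [[]//|n IHn [//|a t]]; rewrite /= ltnS => sn.
have := @mem_bigmax (a :: t) isT; set M := (\max_(x <- _) x)%N => Mt.
rewrite -/(index M (a :: t)); move: (Mt); rewrite -index_mem ltnS => iM.
rewrite !IHn.
- rewrite -[RHS](cat_take_drop (index M (a :: t))).
  by rewrite [in RHS](drop_nth 0%N) ?index_mem // nth_index.
- by rewrite size_drop (leq_trans (leq_subr _ _)).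
- by rewrite size_take_min (leq_trans (geq_minl _ _)) // (leq_trans iM).
Qed.

Lemma inorder_dectree (s : seq nat) : inorder (dectree s) = s.
Proof. exact: inorder_dectree_rec. Qed.

Lemma decreasing_dectree (s : seq nat) : uniq s -> decreasing_tree (dectree s).
Proof.
suff H n (t : seq nat) : (size t <= n)%N -> uniq t ->
    decreasing_tree (dectree_rec n t) by exact: H.
elim: n t => [[]//|n IHn [//|a t]] sn; move: (sn); rewrite ltnS => sn' ut.
have := @mem_bigmax (a :: t) isT.
have ule x : x \in a :: t -> (x <= \max_(x <- a :: t) x)%N.
  by move=> xt; rewrite (big_rem x) // leq_maxl.
have := inorder_dectree_rec sn; move: ule; rewrite -[dectree_rec _ _]/(
  let M := (\max_(x <- a :: t) x)%N in let k := index M (a :: t) in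
  Bin (dectree_rec n (take k (a :: t))) M (dectree_rec n (drop k.+1 (a :: t)))).
set M := (\max_(x <- _) x)%N => ule.
cbv zeta; move: (index _ _) (index_mem M (a :: t)) => k kE eT Mt.
rewrite Mt /= ltnS in kE.
have kn : (k <= n)%N by apply: leq_trans kE _.
set L := dectree_rec n (take _ _); set R := dectree_rec n (drop _ _).
rewrite -/L -/R /= in eT *; apply/and3P; split.
- move: ut ule; rewrite -eT cat_uniq /= negb_or => /and3P[_ /andP[ML _] /andP[MR _]] ule.
  apply/allP => x; rewrite mem_cat => xLR; rewrite ltn_neqAle ule ?andbT.
    by apply: contraTneq xLR => ->; rewrite negb_or ML.
  by move: xLR; rewrite mem_cat inE => /orP[->|->]; rewrite ?orbT.
- apply: IHn; last exact: take_uniq.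
  by rewrite size_take_min (leq_trans (geq_minl _ _)).
- apply: IHn; last exact: (drop_uniq k.+1 (s := a :: t)).
  by rewrite size_drop /= subSS (leq_trans (leq_subr _ _)).
Qed.

Definition forest_axiom A (S : {fset int})
    (F : {fmap {fset int} -> bintree A}) : bool :=
  (domf F == blocks S) && [forall I : domf F, tsize (F I) == #|` val I|].

(* Two forests with the same support and the same trees are equal for =: tree is
   a finite map whose domain is the set of blocks, and the axiom is boolean.
   Unlabeled indexed forests are [forest unit]. *)
Record forest A := Forest {
  support : {fset int};
  tree : {fmap {fset int} -> bintree A};
  _ : forest_axiom support tree
}.

Definition tree_on A (F : forest A) (I : {fset int}) : bintree A :=
  odflt Leaf (tree F).[? I].

Lemma map_forest_subproof A B (f : A -> B) (F : forest A) :
  forest_axiom (support F) [fmap I : domf (tree F) => map_tree f (tree F I)].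
Proof.
case: F => S F /= /andP[dF /forallP sF]; rewrite /forest_axiom /= dF /=.
by apply/forallP => I; rewrite ffunE /tsize inorder_map_tree size_map; apply: sF.
Qed.

Definition map_forest A B (f : A -> B) (F : forest A) : forest B :=
  Forest (map_forest_subproof f F).

Definition shape A (F : forest A) : forest unit := map_forest (fun=> tt) F.

Definition labels A (F : forest A) : seq A :=
  flatten [seq inorder (tree_on F J) | J <- enum_fset (blocks (support F))].

Definition decreasing_forest (F : forest nat) : Prop :=
  perm_eq (labels F) (iota 1 #|` support F|) /\
  forall I, I \in blocks (support F) -> decreasing_tree (tree_on F I).

(* F has a node with canonical label i, interval [l, r] and label p. *)
Definition is_node A (F : forest A) (i l r : int) (p : A) : Prop :=
  exists (I : {fset int}) (L R : bintree (int * A)),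
    let T := Bin L (i, p) R in
    [/\ I \in blocks (support F), subtree T (canon (elts I) (tree_on F I)) &
      forall k, (k \in map fst (inorder T)) = (k \in itv l r)].

Lemma hat_subproof (P : parking_procedure) (W : seq int) :
  forest_axiom (P W) [fmap I : blocks (P W) =>
    dectree [seq outcome P W k | k <- elts (val I)]].
Proof.
rewrite /forest_axiom /= eqxx; apply/forallP => I.
by rewrite ffunE /tsize inorder_dectree size_map size_sort.
Qed.

Definition hatQ (P : parking_procedure) (W : seq int) : forest nat :=
  Forest (hat_subproof P W).

(* The node labeled q in Q, with q counted from 1, is labeled a_q in P. *)
Definition hatP (P : parking_procedure) (W : seq int) : forest int :=
  map_forest (fun q => nth 0 W q.-1) (hatQ P W).

Definition hat (P : parking_procedure) (W : seq int) : forest int * forest nat :=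
  (hatP P W, hatQ P W).

Definition in_image (P : parking_procedure) (FQ : forest int * forest nat) : Prop :=
  exists W, hat P W = FQ.

Definition good_correspondence (P : parking_procedure) : Prop :=
  forall (F : forest int) (Q Q' : forest nat),
    in_image P (F, Q) -> decreasing_forest Q' -> shape Q' = shape Q ->
    in_image P (F, Q').

(* The set to which the label of a node with canonical label i and interval
   [l, r] must belong. *)
Definition allowed (P : parking_procedure) (i l r p : int) : Prop :=
  [\/ p \in itv l (i - 1) /\ DirS P (itv l (i - 1)) p Right,
      p = i |
      p \in itv (i + 1) r /\ DirS P (itv (i + 1) r) p Left].

(* Main.v *)
(* The proof rests on one observation: for a bilateral, locally decided,
   memoryless procedure, a car preferring a spot of a block J of the occupied set
   is sent to a side of J that depends on J and the preferred spot only, because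
   the cars parked in J, taken alone, park exactly in J.

   Let q be the time at which each spot is filled. When spot i is filled, the
   blocks of occupied spots adjacent to i are the maximal intervals [l, i - 1] and
   [i + 1, r] on which q is smaller than q i, and [l, r] is the interval of the
   node i in the decreasing tree of q. Hence a car parks at i if and only if its
   preference is in the allowed set of the node i, which depends on the shape of
   the tree only and not on its decreasing labeling. Every shape has a decreasing
   labeling, for instance by postorder. *)
From mathcomp Require Import all_boot all_order all_algebra finmap zify.
Require Import Defs.

Set Implicit Arguments.
Unset Strict Implicit.
Unset Printing Implicit Defensive.

Import Order.TTheory GRing.Theory Num.Theory.

Local Open Scope fset_scope.
Local Open Scope ring_scope.

(** * Intervals and blocks of finite sets of integers *)

(** The interval may be empty, with [u = t - 1]: this occurs beside a free spot whose neighbour is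
    free too. Nonemptiness is required separately where it matters. *)
Definition maximal_itv (X : pred int) (t u : int) : Prop :=
  [/\ forall k, t <= k <= u -> X k, ~~ X (t - 1) & ~~ X (u + 1)].

(** If two ends differed, the spot just outside one interval would lie in the other, since both
    contain [k]. *)
Lemma maximal_itv_uniq (X : pred int) (t u t' u' k : int) :
  maximal_itv X t u -> maximal_itv X t' u' ->
  t <= k <= u -> t' <= k <= u' -> t = t' /\ u = u'.
Proof.
move=> [sX tX uX] [sX' tX' uX'] kI kI'.
have le1 : t' <= t.
  by rewrite leNgt; apply/negP => lt; move: tX'; rewrite sX //; lia.
have le2 : t <= t'.
  by rewrite leNgt; apply/negP => lt; move: tX; rewrite sX' //; lia.
have le3 : u' <= u.
  by rewrite leNgt; apply/negP => lt; move: uX; rewrite sX' //; lia.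
have le4 : u <= u'.
  by rewrite leNgt; apply/negP => lt; move: uX'; rewrite sX //; lia.
by split; lia.
Qed.

Lemma itv_inj (t u t' u' : int) :
  t <= u -> itv t u = itv t' u' -> t = t' /\ u = u'.
Proof.
move=> tu e.
have mem k : (t <= k <= u) = (t' <= k <= u') by rewrite -!in_itv e.
have := mem t; have := mem u; have := mem t'; have := mem u'.
by split; lia.
Qed.

Lemma is_intervalP (I : {fset int}) :
  reflect (exists t u, t <= u /\ I = itv t u) (is_interval I).
Proof.
apply: (iffP idP) => [/existsP[[t tI] /existsP[[u uI] /eqP /= e]]|[t [u [tu ->]]]].
  by exists t, u; split=> //; move: tI; rewrite e in_itv; lia.
have tI : t \in itv t u by rewrite in_itv; lia.
have uI : u \in itv t u by rewrite in_itv; lia.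
by apply/existsP; exists [` tI]; apply/existsP; exists [` uI].
Qed.

(** Maximality among all intervals inside [S] is tested on the two one-step extensions: a larger
    interval must contain [t - 1] or [u + 1]. *)
Lemma blocksP (S I : {fset int}) :
  reflect (exists t u, [/\ I = itv t u, t <= u & maximal_itv (mem S) t u])
          (I \in blocks S).
Proof.
have Ible t u : t <= u -> is_interval (itv t u).
  by move=> tu; apply/is_intervalP; exists t, u.
rewrite !inE /is_block; apply: (iffP idP) => [|[t [u [-> tu [sS tS uS]]]]].
  case/and4P=> _ /is_intervalP[t [u [tu eI]]] IS /forallP maxI.
  have maxJ t' u' : t' <= u' -> I `<=` itv t' u' -> itv t' u' `<=` S ->
      itv t' u' = I.
    move=> tu' IJ JS; have JP : itv t' u' \in fpowerset S by rewrite fpowersetE.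
    by have /implyP/(_ _)/eqP := maxI [` JP]; apply; rewrite Ible.
  exists t, u; split=> //.
  have IE k : (k \in I) = (t <= k <= u) by rewrite eI in_itv.
  split=> [k|| ].
  - by rewrite -IE => /(fsubsetP IS).
  - apply/negP => /= tS; have /fsetP/(_ (t - 1)) : itv (t - 1) u = I.
      apply: maxJ; first lia.
        by apply/fsubsetP => k; rewrite IE in_itv; lia.
      apply/fsubsetP => k; rewrite in_itv => kI.
      have [->//|ne] := eqVneq k (t - 1).
      by apply: (fsubsetP IS); rewrite IE; lia.
    by rewrite IE in_itv; lia.
  - apply/negP => /= uS; have /fsetP/(_ (u + 1)) : itv t (u + 1) = I.
      apply: maxJ; first lia.
        by apply/fsubsetP => k; rewrite IE in_itv; lia.
      apply/fsubsetP => k; rewrite in_itv => kI.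
      have [->//|ne] := eqVneq k (u + 1).
      by apply: (fsubsetP IS); rewrite IE; lia.
    by rewrite IE in_itv; lia.
have IS : itv t u `<=` S by apply/fsubsetP => k; rewrite in_itv => /sS.
rewrite fpowersetE IS Ible //=; apply/forallP => J; apply/implyP.
case/andP=> /is_intervalP[t' [u' [tu' eJ]]] IJ.
have JS : fsval J `<=` S by have := fsvalP J; rewrite fpowersetE.
move: IJ JS; rewrite eJ => /fsubsetP IJ /fsubsetP JS.
have tJ : t' <= t <= u' by rewrite -in_itv IJ // in_itv; lia.
have uJ : t' <= u <= u' by rewrite -in_itv IJ // in_itv; lia.
have tJ' : ~~ (t' <= t - 1 <= u').
  by apply: contra tS; rewrite -in_itv; exact: (JS _).
have uJ' : ~~ (t' <= u + 1 <= u').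
  by apply: contra uS; rewrite -in_itv; exact: (JS _).
by apply/eqP; congr itv; lia.
Qed.

Lemma itv_blocks (S : {fset int}) (t u : int) :
  t <= u -> maximal_itv (mem S) t u -> itv t u \in blocks S.
Proof. by move=> tu mI; apply/blocksP; exists t, u. Qed.

Lemma itv_block (t u : int) : t <= u -> itv t u \in blocks (itv t u).
Proof.
move=> tu; apply: itv_blocks => //; split=> [k||] /=; rewrite ?in_itv; lia.
Qed.

Lemma maximal_itv_of_block (S : {fset int}) (t u k : int) :
  itv t u \in blocks S -> k \in itv t u -> maximal_itv (mem S) t u.
Proof.
case/blocksP=> t' [u' [e tu' mI]]; rewrite in_itv => kI.
by have [||-> ->] := @itv_inj t u t' u'; rewrite ?e //; lia.
Qed.

(** Pigeonhole on one more point than [S] has elements. The steps [1] and [-1] serve to find the two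
    ends of a block. *)
Lemma exists_notin (S : {fset int}) (x d : int) : d != 0 ->
  exists n : nat, x + d * n%:Z \notin S.
Proof.
move=> d0; pose f (n : 'I_#|` S|.+1) := x + d * (n : nat)%:Z.
have finj : injective f by move=> i j /addrI/(mulfI d0) [/ord_inj].
suff /existsP[n nS] : [exists n, f n \notin S] by exists n.
apply: contraT; rewrite negb_exists => /forallP fS.
have : (#|` [fset f i | i in 'I_#|` S|.+1]| <= #|` S|)%N.
  apply: fsubset_leq_card; apply/fsubsetP => _ /imfsetP[i _ ->].
  by move: (fS i); rewrite negbK.
by rewrite card_imfset //= -cardE card_ord ltnn.
Qed.

Lemma exists_block (S : {fset int}) (x : int) : x \in S ->
  exists t u, [/\ t <= x <= u, itv t u \in blocks S & maximal_itv (mem S) t u].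
Proof.
move=> xS.
have [n nS nmin] := ex_minnP (@exists_notin S x 1 isT).
have [m mS mmin] := ex_minnP (@exists_notin S x (-1) isT).
have n0 : (0 < n)%N by case: n nS {nmin} => //; rewrite mulr0 addr0 xS.
have m0 : (0 < m)%N by case: m mS {mmin} => //; rewrite mulr0 addr0 xS.
(* [n] and [m] are the distances from [x] to the nearest points outside [S] on the right and on the
   left; the block stops one step before them. *)
exists (x - (m%:Z - 1)), (x + (n%:Z - 1)).
have mI : maximal_itv (mem S) (x - (m%:Z - 1)) (x + (n%:Z - 1)).
  split=> [k kI /=||].
  - have [xk|kx] := leP x k.
      apply: contraT => kS; have := nmin `|k - x|%N.
      have -> : x + 1 * `|k - x|%N%:Z = k by lia.
      by move/(_ kS); lia.
    apply: contraT => kS; have := mmin `|k - x|%N.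
    have -> : x + (-1) * `|k - x|%N%:Z = k by lia.
    by move/(_ kS); lia.
  - by have -> : x - (m%:Z - 1) - 1 = x + (-1) * m%:Z by lia.
  - by have -> : x + (n%:Z - 1) + 1 = x + 1 * n%:Z by lia.
by split=> //; [lia | apply: itv_blocks => //; lia].
Qed.

(** * Spots chosen by the successive cars *)

Section ParkingBasics.
Variable P : parking_procedure.
Implicit Types (W V : seq int) (a s : int) (S J : {fset int}).

(** The cardinality axiom makes the difference in [ls] a singleton, so [head] returns its element
    and not the default. *)
Lemma park_rcons W a : ls P W a \notin P W /\ P (rcons W a) = ls P W a |` P W.
Proof.
have sub := park_sub P W a.
have cD : #|` P (rcons W a) `\` P W| = 1%N.
  have := cardfsD (P (rcons W a)) (P W).
  by rewrite (fsetIidPr sub) !card_park size_rcons subSnn.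
have /cardfs1P[s sE] : #|` P (rcons W a) `\` P W| == 1%N by rewrite cD.
have lsE : ls P W a = s by rewrite /ls sE enum_fsetE /= enum_fset1.
have : s \in P (rcons W a) `\` P W by rewrite sE inE.
rewrite inE lsE => /andP[sW _]; split=> //.
by rewrite fsetUC -sE fsetUDl fsetDv fsetD0; apply/esym/fsetUidPr.
Qed.

Lemma ls_eq W a s : s \notin P W -> P (rcons W a) = s |` P W -> ls P W a = s.
Proof.
move=> sW e; have [lW e'] := park_rcons W a.
have : ls P W a \in s |` P W by rewrite -e e' in_fset1U eqxx.
by rewrite in_fset1U (negPf lW) orbF => /eqP.
Qed.

Lemma ls_free W a : a \notin P W -> ls P W a = a.
Proof. by move=> aW; apply: ls_eq => //; apply: park_free. Qed.

Lemma spots_rcons W a : spots P (rcons W a) = rcons (spots P W) (ls P W a).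
Proof.
rewrite /spots size_rcons -addn1 iotaD map_cat cats1 /= add0n.
rewrite -[rcons W a]cats1 take_size_cat // nth_cat ltnn subnn /=; congr rcons.
apply/eq_in_map => k; rewrite mem_iota add0n /= => kW.
by rewrite takel_cat ?(ltnW kW) // nth_cat kW.
Qed.

Lemma size_spots W : size (spots P W) = size W.
Proof. by rewrite size_map size_iota. Qed.

Lemma park_spots W : P W =i spots P W.
Proof.
elim/last_ind: W => [|W a IHW] k; first by rewrite park_nil inE.
have [_ ->] := park_rcons W a.
by rewrite spots_rcons mem_rcons in_fset1U IHW inE.
Qed.

Lemma spots_take W m : spots P (take m W) = take m (spots P W).
Proof.
have [mW|Wm] := leqP m (size W); last first.
  by rewrite !take_oversize ?size_spots // ltnW.
rewrite /spots -map_take take_iota size_takel // (minn_idPl mW).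
apply/eq_in_map => k; rewrite mem_iota add0n /= => km.
by rewrite take_takel ?(ltnW km) // nth_take.
Qed.

End ParkingBasics.

(** * Subwords formed by the cars parked in a union of blocks *)

(** Serves to show that restricting a word to a set, then to a block inside it, amounts to
    restricting to the block. *)
Lemma mask_filter_subset (T : eqType) (p q : pred T) (s : seq T) (A : Type)
    (w : seq A) :
  size s = size w -> {subset p <= q} ->
  mask (map p (filter q s)) (mask (map q s) w) = mask (map p s) w.
Proof.
move=> + pq; elim: s w => [|x s IHs] [|y w] //= [/IHs e].
case qx: (q x) => /=; first by rewrite e.
by have /negbTE -> : ~~ p x by apply: contraFN qx => /pq.
Qed.

(** [T] meets [S] in a union of blocks of [S]. In terms of neighbours, the condition passes to
    subsets of [S], hence to prefixes of a word. *)
Definition adjacency_closed (S T : {fset int}) : Prop :=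
  forall x, x \in S -> x + 1 \in S -> (x \in T) = (x + 1 \in T).

Lemma adjacency_closed_itv (S T : {fset int}) (t u k l : int) :
  adjacency_closed S T -> (forall j, t <= j <= u -> j \in S) ->
  t <= k <= u -> t <= l <= u -> (k \in T) = (l \in T).
Proof.
move=> cT tuS.
suff H j : t <= j <= u -> (j \in T) = (t \in T) by move=> /H-> /H->.
move=> jI; have -> : j = t + `|j - t|%N%:Z by lia.
have : t + `|j - t|%N%:Z <= u by lia.
elim: `|j - t|%N => [|n IHn] nu; first by rewrite addr0.
have -> : t + n.+1%:Z = t + n%:Z + 1 by lia.
by rewrite -cT ?IHn ?tuS //; lia.
Qed.

Section Locality.
Variable P : parking_procedure.
Hypotheses (hbil : bilateral P) (hloc : locally_decided P) (hmem : memoryless P).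
Implicit Types (W V : seq int) (a s : int) (S J : {fset int}).

Lemma restrict_rcons W a J : restrict P (rcons W a) J =
  if ls P W a \in J then rcons (restrict P W J) a else restrict P W J.
Proof.
rewrite /restrict spots_rcons map_rcons mask_rcons ?size_map ?size_iota //.
by case: ifP; rewrite /= ?cats1 ?cats0.
Qed.

(* Closure of [T] under adjacency ensures that each car parking in [T] prefers
   either a free spot or a spot of a block contained in [T]. *)
Lemma spots_restrict W (T : {fset int}) : adjacency_closed (P W) T ->
  spots P (restrict P W T) = [seq s <- spots P W | s \in T].
Proof.
elim/last_ind: W => [//|W a IHW] cT.
have [sW Wa] := park_rcons P W a.
have subW x : x \in P W -> x \in P (rcons W a).
  by move=> xW; rewrite Wa inE xW orbT.
have {}IHW := IHW (fun x xW xW' => cT x (subW _ xW) (subW _ xW')).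
rewrite restrict_rcons spots_rcons filter_rcons.
case: ifP => // sT; rewrite spots_rcons IHW; congr rcons.
have PV k : (k \in P (restrict P W T)) = (k \in P W) && (k \in T).
  by rewrite park_spots IHW mem_filter -park_spots andbC.
have [aW|aW] := boolP (a \in P W); last first.
  by rewrite !ls_free // PV negb_and aW.
have [t [u [atu Jblk mJ]]] := exists_block aW.
have aJ : a \in itv t u by rewrite in_itv.
(* Bilaterality puts the new spot next to the block. Together they form an occupied interval, and
   since the new spot lies in [T], so does the block. *)
have JT k : k \in itv t u -> k \in T.
  rewrite in_itv => kI; have [sJ _ _] := mJ.
  suff -> : (k \in T) = (ls P W a \in T) by [].
  case: (hbil Jblk aJ) => sE; rewrite sE.
    apply: (@adjacency_closed_itv (P (rcons W a)) T (t - 1) u) => //; try lia.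
    move=> j jI; rewrite Wa sE inE; have [->|ne] := eqVneq j (t - 1).
      by rewrite inE eqxx.
    by apply/orP; right; apply: sJ; lia.
  apply: (@adjacency_closed_itv (P (rcons W a)) T t (u + 1)) => //; try lia.
  move=> j jI; rewrite Wa sE inE; have [->|ne] := eqVneq j (u + 1).
    by rewrite inE eqxx.
  by apply/orP; right; apply: sJ; lia.
have Jblk' : itv t u \in blocks (P (restrict P W T)).
  case: mJ => sJ tJ uJ; apply: itv_blocks; first lia.
  split=> [k kI /=||]; rewrite /= PV ?negb_and; last 2 first.
  - by rewrite [_ \notin _]tJ.
  - by rewrite [_ \notin _]uJ.
  - by rewrite [_ \in P W]sJ // JT // in_itv.
(* Local decision applies to both words, and they have the same cars in the block because the block
   lies in [T]. *)
rewrite (hloc Jblk' aJ) (hloc Jblk aJ); congr ls.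
rewrite {1}/restrict IHW /restrict mask_filter_subset ?size_spots //.
Qed.

(** A block is closed under adjacency because both its neighbours are free, so [spots_restrict]
    applies to it. *)
Lemma park_restrict W J : J \in blocks (P W) -> P (restrict P W J) = J.
Proof.
case/blocksP=> t [u [-> tu [sJ tJ uJ]]].
have cJ : adjacency_closed (P W) (itv t u).
  move=> x xW xW'; rewrite !in_itv.
  have : x != t - 1 by apply: contraNneq tJ => <-.
  have : x != u by apply: contraNneq uJ => <-.
  by lia.
apply/fsetP => k; rewrite park_spots spots_restrict // mem_filter -park_spots.
by rewrite in_itv; case: (boolP (t <= k <= u)) => // /sJ.
Qed.

Lemma ls_memoryless W V a : P W = P V -> ls P W a = ls P V a.
Proof.
move=> e; have [M hM] := hmem.
have lsM U : ls P U a = M (P U) a.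
  have [mU Ua] := hM U a.
  by apply: ls_eq => //; rewrite Ua fsetUC.
by rewrite !lsM e.
Qed.

(** Local decision replaces [W] by its cars parked in [J], which fill exactly [J]; memorylessness
    then replaces these by any word filling [J]. *)
Lemma ls_block W V a J :
  J \in blocks (P W) -> a \in J -> P V = J -> ls P W a = ls P V a.
Proof.
move=> Jblk aJ VJ; rewrite (hloc Jblk aJ); apply: ls_memoryless.
by rewrite VJ park_restrict.
Qed.

(** The left side speaks of words filling [J] alone, the right side of a word having [J] among its
    blocks; [ls_block] carries the spot from one to the other. *)
Lemma DirS_block W J t u a d : J \in blocks (P W) -> J = itv t u -> a \in J ->
  DirS P J a d <-> ls P W a = (if d is Right then u + 1 else t - 1).
Proof.
move=> Jblk eJ aJ.
have tu : t <= u by move: aJ; rewrite eJ in_itv; lia.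
split=> [[[V VJ] /(_ V VJ)] | lsE].
  rewrite (ls_block Jblk aJ VJ) => -[t' [u' [blk atu' ->]]].
  move: blk; rewrite VJ eJ => blk.
  have := @maximal_itv_uniq (mem (itv t u)) t' u' t u a
    (maximal_itv_of_block blk atu').
  have mI : maximal_itv (mem (itv t u)) t u.
    by split=> [k||] /=; rewrite in_itv; lia.
  move=> /(_ mI); rewrite -!in_itv -eJ => /(_ atu' aJ) [-> ->].
  by case: d.
(* [DirS] also demands a word filling [J]: the cars of [W] parked there form one. *)
split; first by exists (restrict P W J); apply: park_restrict.
move=> V VJ; exists t, u; split; [|by rewrite -eJ|].
  by rewrite VJ eJ itv_block.
by rewrite -(ls_block Jblk aJ VJ) lsE; case: (d).
Qed.

End Locality.

(** * Preferences that lead to a given spot *)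

Lemma mem_takeE (T : eqType) (s : seq T) m x :
  (x \in take m s) = (x \in s) && (index x s < m)%N.
Proof.
have [xs|xs] := boolP (x \in s); first exact: in_take.
by apply: contraNF xs => /mem_take.
Qed.

(* [l, r] is the interval that the node [s] has in a decreasing tree whose
   nodes with labels smaller than that of [s] are those of [X]. *)
Definition around (X : pred int) (s l r : int) : Prop :=
  [/\ l <= s <= r, ~~ X s, ~~ X (l - 1), ~~ X (r + 1) &
      forall k, l <= k <= r -> k != s -> X k].

Section Step.
Variable P : parking_procedure.
Hypotheses (hbil : bilateral P) (hloc : locally_decided P) (hmem : memoryless P).

(** A car reaches the free spot [s] by preferring it or by being pushed out of one of the two,
    possibly empty, occupied intervals beside it. [DirS_block] says when the push is toward [s]. *)
Lemma ls_allowed W a s l r : around (mem (P W)) s l r ->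
  ls P W a = s <-> allowed P s l r a.
Proof.
move=> [lsr sW lW rW lrW].
have maxL : maximal_itv (mem (P W)) l (s - 1).
  split=> //; last by rewrite subrK.
  by move=> k kI; apply: lrW; lia.
have maxR : maximal_itv (mem (P W)) (s + 1) r.
  split=> //; last by rewrite addrK.
  by move=> k kI; apply: lrW; lia.
have blkL : a \in itv l (s - 1) -> itv l (s - 1) \in blocks (P W).
  by rewrite in_itv => aI; apply: itv_blocks => //; lia.
have blkR : a \in itv (s + 1) r -> itv (s + 1) r \in blocks (P W).
  by rewrite in_itv => aI; apply: itv_blocks => //; lia.
split=> [lsE|].
  have [aW|aW] := boolP (a \in P W); last first.
    by constructor 2; rewrite -lsE ls_free.
  have [t [u [atu blk mtu]]] := exists_block aW.
  have aI : a \in itv t u by rewrite in_itv.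
  have [sJ _ _] := mtu.
  have [lsE'|lsE'] := hbil blk aI.
    have aR : a \in itv (s + 1) r.
      have [||<- <-] // := @maximal_itv_uniq _ t u (s + 1) r t mtu maxR.
        by lia.
      have : t - 1 = s by rewrite -lsE' lsE.
      (* Otherwise [r = s], and the spot [r + 1 = t] would be both free and in the block. *)
      move=> ts; suff : t <= r by lia.
      rewrite leNgt; apply/negP => rt.
      by move: rW; have -> : r + 1 = t by [lia]; rewrite sJ //; lia.
    constructor 3; split=> //.
    by apply/(DirS_block hbil hloc hmem _ (blkR aR) erefl aR); rewrite lsE addrK.
  have aL : a \in itv l (s - 1).
    have [||<- <-] // := @maximal_itv_uniq _ t u l (s - 1) u mtu maxL.
      by lia.
    have : u + 1 = s by rewrite -lsE' lsE.
    move=> us; suff : l <= u by lia.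
    rewrite leNgt; apply/negP => ul.
    by move: lW; have -> : l - 1 = u by [lia]; rewrite sJ //; lia.
  constructor 1; split=> //.
  by apply/(DirS_block hbil hloc hmem _ (blkL aL) erefl aL); rewrite lsE subrK.
case=> [[aL /(DirS_block hbil hloc hmem _ (blkL aL) erefl aL) ->]|->|].
- by rewrite subrK.
- exact: ls_free.
- by move=> [aR /(DirS_block hbil hloc hmem _ (blkR aR) erefl aR) ->]; rewrite addrK.
Qed.

Lemma spots_allowed W k l r : k \in P W ->
  around (fun x => (x \in P W) && (outcome P W x < outcome P W k)%N) k l r ->
  allowed P k l r (nth 0 W (outcome P W k).-1).
Proof.
(* [outcome] counts from 1, so [m] cars precede the one that fills [k], and they occupy exactly the
   spots of smaller outcome. *)
set m := index k (spots P W); rewrite park_spots => kW ar.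
have mW : (m < size W)%N by rewrite -(size_spots P) index_mem.
have eP x : (x \in P (take m W)) =
    (x \in P W) && (outcome P W x < outcome P W k)%N.
  rewrite park_spots spots_take mem_takeE.
  by rewrite park_spots /outcome ltnS.
have ar' : around (mem (P (take m W))) k l r.
  case: ar => h1 h2 h3 h4 h5; split; rewrite //= ?eP //.
  by move=> x xI xk; rewrite eP; exact: h5.
apply/(ls_allowed _ ar').
have := nth_index 0 kW; rewrite (nth_map 0%N) ?size_iota //.
by rewrite nth_iota.
Qed.

(** The cars are followed in order: once the first [m] have filled [take m sp], the next preference
    is allowed for the next spot and [ls_allowed] sends the car there. *)
Lemma allowed_spots (W sp : seq int) : size W = size sp -> uniq sp ->
  (forall m, (m < size sp)%N -> exists l r,
    around (mem (take m sp)) (nth 0 sp m) l r /\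
    allowed P (nth 0 sp m) l r (nth 0 W m)) ->
  spots P W = sp.
Proof.
move=> sW usp ok.
suff H m : (m <= size sp)%N -> spots P (take m W) = take m sp.
  by have := H _ (leqnn _); rewrite take_size -sW take_size.
elim: m => [|m IHm] mS; first by rewrite !take0.
rewrite !(take_nth 0) ?sW // spots_rcons IHm 1?ltnW //; congr rcons.
have [l [r [ar al]]] := ok m mS; apply/(@ls_allowed _ _ _ l r) => //.
have eP x : (x \in P (take m W)) = (x \in take m sp).
  by rewrite park_spots IHm // ltnW.
case: ar => h1 h2 h3 h4 h5; split; rewrite //= ?eP //.
by move=> x xI xk; rewrite eP; exact: h5.
Qed.

End Step.

(** * Binary trees and decreasing labelings *)

Lemma map_tree_comp (A B C : Type) (f : A -> B) (g : B -> C) (T : bintree A) :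
  map_tree g (map_tree f T) = map_tree (g \o f) T.
Proof. by elim: T => //= L -> x R ->. Qed.

Lemma eq_map_tree (A B : Type) (f g : A -> B) (T : bintree A) :
  f =1 g -> map_tree f T = map_tree g T.
Proof. by move=> fg; elim: T => //= L -> x R ->; rewrite fg. Qed.

Lemma tsize_map_tree (A B : Type) (f : A -> B) (T : bintree A) :
  tsize (map_tree f T) = tsize T.
Proof. by rewrite /tsize inorder_map_tree size_map. Qed.

Lemma cat_inj_size (A : Type) (s1 s2 t1 t2 : seq A) :
  size s1 = size t1 -> s1 ++ s2 = t1 ++ t2 -> s1 = t1 /\ s2 = t2.
Proof.
move=> es e; split.
  by rewrite -[LHS](take_size_cat s2 erefl) e take_size_cat.
by rewrite -[LHS](@drop_size_cat _ _ s1 s2 erefl) e drop_size_cat.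
Qed.

(** Equal shapes have left subtrees of equal size, so both in-order words split at the root in the
    same place. *)
Lemma tree_inj_shape (A : Type) (T T' : bintree A) :
  map_tree (fun=> tt) T = map_tree (fun=> tt) T' ->
  inorder T = inorder T' -> T = T'.
Proof.
elim: T T' => [|L IHL x R IHR] [|L' x' R'] //= [eL eR].
case/cat_inj_size.
  by have := tsize_map_tree (fun=> tt) L; rewrite eL tsize_map_tree.
by move=> /(IHL _ eL)-> [-> /(IHR _ eR)->].
Qed.

Lemma map_tree_subtree (A B : Type) (f : A -> B) (V : bintree B) (U : bintree A) :
  subtree V (map_tree f U) <-> exists2 V', subtree V' U & V = map_tree f V'.
Proof.
elim: U => [|L IHL x R IHR] /=; first by split=> // -[].
split=> [[->|/IHL[V' sV ->]|/IHR[V' sV ->]]|[V' [->|sV|sV] eV]].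
- by exists (Bin L x R) => //; constructor.
- by exists V' => //; constructor 2.
- by exists V' => //; constructor 3.
- by constructor 1; rewrite eV.
- by constructor 2; apply/IHL; exists V'.
- by constructor 3; apply/IHR; exists V'.
Qed.

Lemma mem_inorder_subtree (A : eqType) (U : bintree A) (x : A) :
  x \in inorder U -> exists L R, subtree (Bin L x R) U.
Proof.
elim: U => //= L IHL y R IHR; rewrite mem_cat inE => /or3P[/IHL|/eqP->|/IHR].
- by move=> [L' [R' sV]]; exists L', R'; constructor 2.
- by exists L, R; constructor 1.
- by move=> [L' [R' sV]]; exists L', R'; constructor 3.
Qed.

(** The in-order neighbours of a subtree are ancestors of its root, hence have larger labels. The
    defaults of [last] and [head] are excluded by the nonemptiness conditions. *)
Lemma decreasing_subtree (q : int -> nat) (U L R : bintree int) (i : int) :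
  decreasing_tree (map_tree q U) -> subtree (Bin L i R) U ->
  exists s1 s2,
    [/\ inorder U = s1 ++ inorder (Bin L i R) ++ s2,
        all (fun x => q x < q i)%N (inorder L ++ inorder R),
        s1 != [::] -> (q i < q (last 0%R s1))%N &
        s2 != [::] -> (q i < q (head 0%R s2))%N].
Proof.
elim: U => //= L0 IHL y R0 IHR /and3P[].
rewrite !inorder_map_tree -map_cat all_map all_cat => /andP[aL aR] dL dR.
case=> [[-> -> ->]|sL|sR].
- by exists [::], [::]; rewrite cats0 all_cat; split=> //; apply/andP.
- have [s1 [s2 [e a h1 h2]]] := IHL dL sL.
  have iL : i \in inorder L0 by rewrite e !mem_cat /= inE eqxx !orbT.
  exists s1, (s2 ++ y :: inorder R0); rewrite e -!catA /=; split=> //.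
  by case: s2 h2 {e} => [_ _|z s2 h2 _] /=; [exact: (allP aL) | exact: h2].
- have [s1 [s2 [e a h1 h2]]] := IHR dR sR.
  have iR : i \in inorder R0 by rewrite e !mem_cat /= inE eqxx !orbT.
  exists (inorder L0 ++ y :: s1), s2; rewrite e -!catA /=; split=> //.
  rewrite last_cat /=.
  by case: s1 h1 {e} => [_ _|z s1 h1 _] /=; [exact: (allP aR) | exact: h1].
Qed.

(** All other labels are strictly smaller than that of the root, so the maximum occurs once and
    [dectree] splits the in-order word at the root. *)
Lemma dectree_inorder (T : bintree nat) :
  decreasing_tree T -> dectree (inorder T) = T.
Proof.
suff H n (V : bintree nat) : (tsize V <= n)%N -> decreasing_tree V ->
    dectree_rec n (inorder V) = V by exact: H.
have tE A L (x : A) R : tsize (Bin L x R) = (tsize L + tsize R).+1.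
  by rewrite /tsize /= size_cat addnS.
elim: n V => [|n IHn] [|L x R] //; rewrite tE // ltnS => sn /and3P[aLR dL dR].
have maxE : (\max_(y <- inorder L ++ x :: inorder R) y)%N = x.
  apply/eqP; rewrite eqn_leq; apply/andP; split.
    apply/bigmax_leqP_seq => y; rewrite mem_cat inE orbCA -mem_cat.
    by case/predU1P=> [->//|/(allP aLR)/ltnW].
  by rewrite (big_rem x) ?leq_maxl // mem_cat mem_head orbT.
have idxE : index x (inorder L ++ x :: inorder R) = size (inorder L).
  rewrite index_cat /= eqxx addn0; case: ifP => // xL.
  by have := allP aLR x; rewrite mem_cat xL ltnn => /(_ isT).
(* The word [inorder L ++ x :: inorder R] exhibits no head constructor, so the recursion is unfolded
   through this equation. *)
have dE s : s != [::] -> dectree_rec n.+1 s =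
    let M := (\max_(y <- s) y)%N in let k := index M s in
    Bin (dectree_rec n (take k s)) M (dectree_rec n (drop k.+1 s)).
  by case: s.
rewrite [inorder _]/= dE; last by case: (inorder L).
cbv zeta; rewrite maxE idxE take_size_cat // -cat_rcons drop_size_cat.
  by rewrite !IHn //; lia.
by rewrite size_rcons.
Qed.

(** * Canonical labels *)

Lemma inorder_canon (A : Type) (s : seq int) (T : bintree A) :
  size s = tsize T -> inorder (canon s T) = zip s (inorder T).
Proof.
rewrite /tsize; elim: T s => [|L IHL x R IHR] /= s; first by case: s.
rewrite size_cat /= => ss; rewrite IHL ?IHR; last 2 first.
- by rewrite size_drop ss /tsize; lia.
- by rewrite size_takel // ss /tsize; lia.
rewrite -{4}[s](cat_take_drop (tsize L)) zip_cat; last first.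
  by rewrite size_takel // ss /tsize; lia.
by rewrite [in RHS](drop_nth 0) ?ss /tsize //; lia.
Qed.

Lemma map_canon (A B : Type) (f : A -> B) (s : seq int) (T : bintree A) :
  canon s (map_tree f T) = map_tree (fun kx => (kx.1, f kx.2)) (canon s T).
Proof. by elim: T s => //= L IHL x R IHR s; rewrite IHL IHR tsize_map_tree. Qed.

Lemma canonK (A : Type) (s : seq int) (T : bintree A) :
  map_tree snd (canon s T) = T.
Proof. by elim: T s => //= L IHL x R IHR s; rewrite IHL IHR. Qed.

(** These labels depend on the shape only, and a labeling given by a function of the spot is
    recovered by mapping that function over them. *)
Definition keys (A : Type) (s : seq int) (T : bintree A) : bintree int :=
  map_tree fst (canon s T).

Lemma keys_shape (A B : Type) (s : seq int) (T : bintree A) (T' : bintree B) :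
  map_tree (fun=> tt) T = map_tree (fun=> tt) T' -> keys s T = keys s T'.
Proof.
have H (C : Type) (V : bintree C) : keys s V = keys s (map_tree (fun=> tt) V).
  by rewrite /keys map_canon map_tree_comp; apply: eq_map_tree.
by move=> e; rewrite H e -H.
Qed.

Lemma inorder_keys (A : Type) (s : seq int) (T : bintree A) :
  size s = tsize T -> inorder (keys s T) = s.
Proof.
by move=> ss; rewrite inorder_map_tree inorder_canon // -/unzip1 unzip1_zip ?ss.
Qed.

Lemma canonE (A : Type) (s : seq int) (T : bintree A) (p : int -> A) :
  inorder T = map p s -> canon s T = map_tree (fun k => (k, p k)) (keys s T).
Proof.
move=> e; have ss : size s = tsize T by rewrite /tsize e size_map.
apply: tree_inj_shape.
  by rewrite map_tree_comp [RHS]map_tree_comp; apply: eq_map_tree.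
rewrite inorder_canon // inorder_map_tree inorder_keys // e.
by elim: (s) => //= k s' ->.
Qed.

Lemma map_keys (A : Type) (s : seq int) (T : bintree A) (p : int -> A) :
  inorder T = map p s -> map_tree p (keys s T) = T.
Proof.
by move=> e; rewrite -[RHS](canonK s) (canonE e) map_tree_comp; apply: eq_map_tree.
Qed.

(** The explicit length lets a block be cut along a concatenation of in-order words. *)
Definition irange (t : int) (n : nat) : seq int := [seq t + k%:Z | k <- iota 0 n].

Lemma size_irange t n : size (irange t n) = n.
Proof. by rewrite size_map size_iota. Qed.

Lemma mem_irange t n k : (k \in irange t n) = (t <= k < t + n%:Z).
Proof.
apply/mapP/idP => [[j + ->]|kI]; first by rewrite mem_iota; lia.
by exists `|k - t|%N; rewrite ?mem_iota; lia.
Qed.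

Lemma irange_cat t m n : irange t (m + n) = irange t m ++ irange (t + m%:Z) n.
Proof.
rewrite /irange iotaD map_cat add0n; congr cat.
rewrite -[m in iota m]addn0 iotaDl -map_comp; apply: eq_map => k /=; lia.
Qed.

Lemma last_irange x t n : last x (irange t n.+1) = t + n%:Z.
Proof. by rewrite -addn1 irange_cat last_cat /= addr0. Qed.

Lemma elts_itv t u : t <= u -> elts (itv t u) = irange t `|u - t|.+1.
Proof.
move=> tu; apply: (sorted_eq le_trans le_anti).
- by apply: sort_sorted; apply: le_total.
- have : {homo (fun k : nat => t + k%:Z) : x y / (x <= y)%N >-> x <= y}.
    by move=> x y /=; lia.
  by move/homo_sorted; apply; apply: iota_sorted.
- rewrite perm_sort; apply: uniq_perm; first exact: fset_uniq.
    by rewrite map_inj_uniq ?iota_uniq // => x y; lia.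
  by move=> k; rewrite mem_irange in_itv; lia.
Qed.

(** * Indexed forests and their labelings *)

Lemma forest_inj (A : Type) (F G : forest A) : support F = support G ->
  (forall I, I \in blocks (support F) -> tree_on F I = tree_on G I) -> F = G.
Proof.
case: F G => [S f fP] [S' g gP] /= e; case: S' / e gP => gP eFG.
suff efg : f = g.
  by case: g / efg gP eFG => gP _; congr Forest; apply: bool_irrelevance.
have [/eqP df _] := andP fP; have [/eqP dg _] := andP gP.
apply/fmapP => I; have [IS|IS] := boolP (I \in blocks S); last first.
  have If : I \notin domf f by rewrite df.
  have Ig : I \notin domf g by rewrite dg.
  by rewrite !not_fnd.
have If : I \in domf f by rewrite df.
have Ig : I \in domf g by rewrite dg.
by have := eFG I IS; rewrite /tree_on /= !in_fnd /= => ->.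
Qed.

Lemma tree_on_map (A B : Type) (f : A -> B) (F : forest A) I :
  tree_on (map_forest f F) I = map_tree f (tree_on F I).
Proof.
rewrite /tree_on /=; have [IF|IF] := boolP (I \in domf (tree F)).
  by rewrite !in_fnd /= ffunE; congr (map_tree f (tree F _)); apply: val_inj.
by rewrite !not_fnd.
Qed.

Lemma tsize_tree_on (A : Type) (F : forest A) I :
  I \in blocks (support F) -> size (elts I) = tsize (tree_on F I).
Proof.
case: F => S f /= fP IS; have [/eqP df /forallP sf] := andP fP.
have If : I \in domf f by rewrite df.
by rewrite size_sort /tree_on /= in_fnd /= (eqP (sf [` If])).
Qed.

Lemma shape_tree_on (A B : Type) (F : forest A) (Q : forest B) I :
  shape F = shape Q ->
  map_tree (fun=> tt) (tree_on F I) = map_tree (fun=> tt) (tree_on Q I).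
Proof. by rewrite -!tree_on_map -/(shape _) => ->. Qed.

Lemma shape_map_forest (A B : Type) (f : A -> B) (F : forest A) :
  shape (map_forest f F) = shape F.
Proof.
apply: forest_inj => // I _; rewrite !tree_on_map map_tree_comp.
exact: eq_map_tree.
Qed.

Lemma support_shape (A B : Type) (F : forest A) (Q : forest B) :
  shape F = shape Q -> support F = support Q.
Proof. by move/(congr1 (@support _)). Qed.

Lemma shape_inj (A : Type) (F G : forest A) : shape F = shape G ->
  (forall I, I \in blocks (support F) ->
    inorder (tree_on F I) = inorder (tree_on G I)) -> F = G.
Proof.
move=> sFG iFG; apply: forest_inj; first exact: support_shape.
by move=> I IS; apply: tree_inj_shape; [exact: shape_tree_on | exact: iFG].
Qed.

Definition labelled_by (A : Type) (F : forest A) (p : int -> A) : Prop :=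
  forall I, I \in blocks (support F) -> inorder (tree_on F I) = map p (elts I).

(** Separates the label from the interval, which is read on [keys] and thus depends on the shape
    only. *)
Lemma is_nodeP (A : Type) (F : forest A) (p : int -> A) i l r x :
  labelled_by F p ->
  is_node F i l r x <-> x = p i /\ exists (I : {fset int}) L R,
    [/\ I \in blocks (support F),
        subtree (Bin L i R) (keys (elts I) (tree_on F I)) &
        forall k, (k \in inorder (Bin L i R)) = (k \in itv l r)].
Proof.
move=> Fp; split=> [[I [L [R [IS]]]]|[-> [I [L [R [IS sT kT]]]]]].
  rewrite (canonE (Fp I IS)) => /map_tree_subtree[[|L' i' R'] // sT] [eL eI ex eR] kT.
  subst i' x; split=> //; exists I, L', R'; split=> // k; rewrite -kT /=.
  by rewrite eL eR !inorder_map_tree map_cat /= -!map_comp !map_id.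
pose f k := (k, p k); exists I, (map_tree f L), (map_tree f R); split=> //.
  by rewrite (canonE (Fp I IS)); apply/map_tree_subtree; exists (Bin L i R).
move=> k; rewrite -kT /= !inorder_map_tree map_cat /= -!map_comp.
by rewrite !(@eq_map _ _ (fst \o f) id) // !map_id.
Qed.

(** * Intervals of the nodes of a forest with a decreasing labeling *)

Section Nodes.
Variables (A : Type) (F : forest A) (Q : forest nat).
Variables (p : int -> A) (q : int -> nat).
Hypotheses (shapeFQ : shape F = shape Q) (Fp : labelled_by F p).
Hypotheses (Qq : labelled_by Q q).
Hypothesis decQ :
  forall I, I \in blocks (support Q) -> decreasing_tree (tree_on Q I).

(** A subtree covers consecutive spots of its block. Beyond each end lies a spot outside the support
    or, by [decreasing_subtree], one with a larger [q]. *)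
Lemma subtree_around I L R i :
  I \in blocks (support F) -> subtree (Bin L i R) (keys (elts I) (tree_on F I)) ->
  exists l r, [/\ forall k, (k \in inorder (Bin L i R)) = (k \in itv l r),
    i \in support F & around (fun k => (k \in support F) && (q k < q i)%N) i l r].
Proof.
move=> IS; rewrite (keys_shape _ (shape_tree_on I shapeFQ)) => sT.
have IQ : I \in blocks (support Q) by rewrite -(support_shape shapeFQ).
have := decQ IQ; rewrite -(map_keys (Qq IQ)) => /decreasing_subtree/(_ sT).
move=> [s1 [s2 [e a h1 h2]]]; move: e; rewrite (inorder_keys (tsize_tree_on IQ)).
have /blocksP[t [u [-> tu [sS tS uS]]]] := IS; rewrite elts_itv //.
set T := inorder (Bin L i R).
have [m Tm] : exists m, size T = m.+1.
  by exists (size (inorder L) + size (inorder R))%N; rewrite size_cat addnS.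
move=> e; have eu : u - t + 1 = (size s1 + (m.+1 + size s2))%N%:Z.
  by have := congr1 size e; rewrite size_irange size_cat size_cat Tm; lia.
move: e; have -> : `|u - t|.+1 = (size s1 + (m.+1 + size s2))%N by lia.
rewrite !irange_cat.
case/cat_inj_size; first by rewrite size_irange.
move=> es1 /cat_inj_size[]; first by rewrite size_irange Tm.
(* The block starts at [t], the spots of [s1] precede the subtree, and the subtree has [m + 1]
   nodes. *)
move=> eT es2; exists (t + (size s1)%:Z), (t + (size s1)%:Z + m%:Z).
have memT k : (k \in T) = (k \in itv (t + (size s1)%:Z) (t + (size s1)%:Z + m%:Z)).
  by rewrite -eT mem_irange in_itv; lia.
have iT : i \in T by rewrite mem_cat mem_head orbT.
move: (iT); rewrite memT in_itv => iI.
have iS : i \in support F by apply: (sS i); lia.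
split=> //; split=> //.
- by rewrite ltnn andbF.
- case: (size s1) h1 es1 (size_eq0 s1) {eT es2 eu memT iI} => [|n] h1 es1 s10.
    by rewrite addr0 [_ \in _](negPf tS).
  have s1n : s1 != [::] by rewrite -s10.
  move: (h1 s1n); rewrite -es1 last_irange => lt.
  have -> : t + n.+1%:Z - 1 = t + n%:Z by lia.
  by rewrite ltnNge (ltnW lt) andbF.
- case: (size s2) h2 es2 (size_eq0 s2) eu {es1} => [|n] h2 es2 s20 eu.
    have -> : t + (size s1)%:Z + m%:Z + 1 = u + 1 by lia.
    by rewrite [_ \in _](negPf uS).
  have s2n : s2 != [::] by rewrite -s20.
  move: (h2 s2n); rewrite -es2 /= addr0 => lt.
  have -> : t + (size s1)%:Z + m%:Z + 1 = t + (size s1)%:Z + m.+1%:Z by lia.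
  by rewrite ltnNge (ltnW lt) andbF.
move=> k kI ki; rewrite [k \in _]sS /=; last by lia.
apply: (allP a); have : k \in T by rewrite memT in_itv.
by rewrite /T /= !mem_cat inE (negPf ki).
Qed.

Lemma is_node_around i l r x : is_node F i l r x ->
  [/\ x = p i, i \in support F &
      around (fun k => (k \in support F) && (q k < q i)%N) i l r].
Proof.
case/(is_nodeP _ _ _ _ Fp) => -> [I [L [R [IS sT kT]]]].
have [l' [r' [kT' iS ar]]] := subtree_around IS sT.
have iT : i \in itv l r by rewrite -kT mem_cat mem_head orbT.
have e : itv l r = itv l' r' by apply/fsetP => k; rewrite -kT kT'.
have [|-> ->] := itv_inj _ e; first by move: iT; rewrite in_itv; lia.
by [].
Qed.

Lemma node_around i : i \in support F -> exists l r,
  is_node F i l r (p i) /\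
  around (fun k => (k \in support F) && (q k < q i)%N) i l r.
Proof.
move=> iS; have [t [u [itu IS _]]] := exists_block iS.
have : i \in inorder (keys (elts (itv t u)) (tree_on F (itv t u))).
  by rewrite (inorder_keys (tsize_tree_on IS)) mem_sort in_itv.
move=> /mem_inorder_subtree[L [R sT]].
have [l [r [kT _ ar]]] := subtree_around IS sT.
exists l, r; split=> //; apply/(is_nodeP _ _ _ _ Fp); split=> //.
by exists (itv t u), L, R.
Qed.

End Nodes.

(** * The blocks as a partition of the support *)

Lemma mem_block_uniq (S I J : {fset int}) k :
  I \in blocks S -> J \in blocks S -> k \in I -> k \in J -> I = J.
Proof.
move=> /blocksP[t [u [-> tu mI]]] /blocksP[t' [u' [-> tu' mJ]]].
by rewrite !in_itv => kI kJ; have [-> ->] := maximal_itv_uniq mI mJ kI kJ.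
Qed.

Lemma exists_labelled_by (A : Type) (d : A) (F : forest A) :
  exists p, labelled_by F p.
Proof.
(* Blocks are disjoint, so for [k] in the support [Bs k] consists of one block, and neither default,
   [fset0] or [d], is reached. *)
pose Bs k : seq {fset int} := [seq I <- enum_fset (blocks (support F)) | k \in I].
pose B k := head fset0 (Bs k).
pose p k := nth d (inorder (tree_on F (B k))) (index k (elts (B k))).
exists p => I IS.
have BE k : k \in I -> B k = I.
  move=> kI; have : B k \in Bs k.
    have : I \in Bs k by rewrite mem_filter kI.
    by rewrite /B; case: (Bs k) => // *; apply: mem_head.
  by rewrite mem_filter => /andP[kB BS]; apply: (mem_block_uniq BS IS kB kI).
have sI := tsize_tree_on IS.
apply: (@eq_from_nth _ d) => [|j jT]; first by rewrite size_map sI.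
have jI : (j < size (elts I))%N by rewrite sI.
rewrite (nth_map 0) // /p BE; last by rewrite -(mem_sort <=%R) mem_nth.
by rewrite index_uniq // sort_uniq fset_uniq.
Qed.

Lemma perm_elts_blocks (S : {fset int}) :
  perm_eq (flatten [seq elts J | J <- enum_fset (blocks S)]) (enum_fset S).
Proof.
apply: uniq_perm; last 2 first.
- exact: fset_uniq.
- move=> k; apply/flatten_mapP/idP => [[I /blocksP[t [u [-> tu [sS _ _]]]]]|kS].
    by rewrite mem_sort in_itv => /sS.
  have [t [u [ktu blk _]]] := exists_block kS.
  by exists (itv t u) => //; rewrite mem_sort in_itv.
have -> : flatten [seq elts J | J <- enum_fset (blocks S)] =
    [seq k | J <- enum_fset (blocks S), k <- elts J].
  by congr flatten; apply: eq_map => I; rewrite map_id.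
apply: allpairs_uniq_dep => [|I _|]; first exact: fset_uniq.
  by rewrite sort_uniq fset_uniq.
move=> [I k] [J l] /allpairsPdep[I' [k' [I'S kI' [-> ->]]]].
move=> /allpairsPdep[J' [l' [J'S lJ' [-> ->]]]] /= ekl.
move: kI' lJ'; rewrite ekl !mem_sort => lI lJ.
by rewrite (mem_block_uniq I'S J'S lI lJ).
Qed.

(** * A decreasing labeling for every shape *)

Fixpoint postorder (A : Type) (n : nat) (T : bintree A) : bintree nat :=
  if T is Bin L x R then
    Bin (postorder n L) (n + tsize L + tsize R)%N (postorder (n + tsize L) R)
  else Leaf.

Lemma perm_postorder (A : Type) n (T : bintree A) :
  perm_eq (inorder (postorder n T)) (iota n (tsize T)).
Proof.
elim: T n => // L IHL x R IHR n; rewrite [postorder _ _]/= [inorder _]/=.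
have -> : tsize (Bin L x R) = (tsize L + (tsize R + 1))%N.
  by rewrite /tsize /= size_cat addn1.
rewrite !iotaD /=; apply: perm_cat (IHL n) _.
by rewrite -cat1s perm_catC; apply: perm_cat (IHR _) _.
Qed.

Lemma shape_postorder (A : Type) n (T : bintree A) :
  map_tree (fun=> tt) (postorder n T) = map_tree (fun=> tt) T.
Proof. by elim: T n => //= L IHL x R IHR n; rewrite IHL IHR. Qed.

Lemma decreasing_postorder (A : Type) n (T : bintree A) :
  decreasing_tree (postorder n T).
Proof.
elim: T n => //= L IHL x R IHR n; rewrite IHL IHR !andbT.
apply/allP => y; rewrite mem_cat !(perm_mem (perm_postorder _ _)) !mem_iota.
by lia.
Qed.

(** Each tree starts numbering where the previous one stopped, so the labels of the whole forest are
    consecutive. *)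
Fixpoint postorders (A : Type) (n : nat) (ts : seq (bintree A)) :=
  if ts is T :: ts' then postorder n T :: postorders (n + tsize T) ts' else [::].

Lemma perm_postorders (A : Type) n (ts : seq (bintree A)) :
  perm_eq (flatten [seq inorder T | T <- postorders n ts])
    (iota n (sumn [seq tsize T | T <- ts])).
Proof.
elim: ts n => //= T ts IHts n.
by rewrite iotaD perm_cat ?perm_postorder.
Qed.

Lemma size_postorders (A : Type) n (ts : seq (bintree A)) :
  size (postorders n ts) = size ts.
Proof. by elim: ts n => //= T ts IHts n; rewrite IHts. Qed.

Lemma nth_postorders (A : Type) n (ts : seq (bintree A)) i :
  exists m, nth Leaf (postorders n ts) i = postorder m (nth Leaf ts i).
Proof.
elim: ts n i => [|T ts IHts] n [|i] /=; try by exists n.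
exact: IHts.
Qed.

Lemma exists_decreasing_forest (A : Type) (F : forest A) :
  exists2 Q, decreasing_forest Q & shape Q = shape F.
Proof.
pose bs := enum_fset (blocks (support F)).
pose ts := [seq tree_on F J | J <- bs].
(* The numbering runs along a list whereas a forest is a map on blocks: each block finds its tree at
   its index in [bs]. *)
pose f (I : {fset int}) := nth Leaf (postorders 1 ts) (index I bs).
have fE I : I \in bs -> exists m, f I = postorder m (tree_on F I).
  move=> IS; have [m e] := nth_postorders 1 ts (index I bs).
  by exists m; rewrite /f e (nth_map fset0) ?index_mem // nth_index.
have fP : forest_axiom (support F) [fmap I : blocks (support F) => f (val I)].
  rewrite /forest_axiom /= eqxx; apply/forallP => I; rewrite ffunE.
  have IS : val I \in bs := valP I.
  have [m ->] := fE _ IS.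
  by rewrite -(tsize_map_tree (fun=> tt)) shape_postorder tsize_map_tree
    -tsize_tree_on // size_sort.
pose Q := Forest fP.
have QE I : I \in blocks (support F) -> tree_on Q I = f I.
  by move=> IS; rewrite /tree_on /= in_fnd /= ffunE.
have sQ : labels Q = flatten [seq inorder T | T <- postorders 1 ts].
  rewrite /labels /=; congr flatten.
  have -> : postorders 1 ts = map f bs.
    apply: (@eq_from_nth _ Leaf) => [|i]; rewrite size_postorders !size_map // => ib.
    by rewrite (nth_map fset0) // /f index_uniq // fset_uniq.
  by rewrite -map_comp; apply/eq_in_map => I IS /=; rewrite QE.
exists Q; first split.
- rewrite sQ; apply: perm_trans (perm_postorders _ _) _.
  suff -> : sumn [seq tsize T | T <- ts] = #|` support F| by [].
  rewrite -(perm_size (perm_elts_blocks _)) size_flatten /seq.shape -!map_comp.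
  congr sumn; apply/eq_in_map => I IS /=.
  by rewrite (tsize_tree_on IS).
- by move=> I IS; rewrite QE //; have [m ->] := fE I IS; apply: decreasing_postorder.
apply: forest_inj => // I IS; rewrite !tree_on_map QE //.
by have [m ->] := fE I IS; rewrite shape_postorder.
Qed.

(** * The image of the correspondence *)

Lemma eq_around (X Y : pred int) s l r :
  X =1 Y -> around X s l r -> around Y s l r.
Proof.
move=> XY [h1 h2 h3 h4 h5]; split; rewrite -?XY // => k kI ks.
by rewrite -XY; apply: h5.
Qed.

(** The label of a spot in [hatQ P W] is the time at which it is filled, so [is_node_around]
    provides what [spots_allowed] requires. *)
Lemma in_image_allowed (P : parking_procedure) (F : forest int) (Q : forest nat)
    (hbil : bilateral P) (hloc : locally_decided P) (hmem : memoryless P) :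
  in_image P (F, Q) ->
  forall i l r p, is_node F i l r p -> allowed P i l r p.
Proof.
move=> [W [<- _]] i l r x.
have sFQ : shape (hatP P W) = shape (hatQ P W).
  exact: shape_map_forest.
have QE I : I \in blocks (P W) ->
    tree_on (hatQ P W) I = dectree [seq outcome P W k | k <- elts I].
  by move=> IS; rewrite /tree_on /= in_fnd /= ffunE.
have Qq : labelled_by (hatQ P W) (outcome P W).
  by move=> I IS; rewrite QE // inorder_dectree.
have Fp : labelled_by (hatP P W) (fun k => nth 0 W (outcome P W k).-1).
  by move=> I IS; rewrite tree_on_map inorder_map_tree Qq // -map_comp.
have decQ I : I \in blocks (P W) -> decreasing_tree (tree_on (hatQ P W) I).
  move=> IS; rewrite QE //; apply: decreasing_dectree.
  (* Distinct occupied spots are filled by distinct cars, so the outcomes on a block do not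
     repeat. *)
  rewrite map_inj_in_uniq ?sort_uniq ?fset_uniq // => j k.
  have /blocksP[t [u [-> _ [sS _ _]]]] := IS.
  rewrite !mem_sort !in_itv => /sS + /sS; rewrite /= !park_spots => jW kW [].
  by move=> e; rewrite -(nth_index 0 jW) e nth_index.
move=> /(is_node_around sFQ Fp Qq decQ)[-> iW ar].
exact: (spots_allowed hbil hloc hmem iW ar).
Qed.

(** The labels of [Q] prescribe the order in which spots are filled; the labels of [F] read in that
    order form the word. *)
Lemma allowed_in_image (P : parking_procedure) (F : forest int) (Q : forest nat)
    (hbil : bilateral P) (hloc : locally_decided P) (hmem : memoryless P) :
  shape F = shape Q -> decreasing_forest Q ->
  (forall i l r p, is_node F i l r p -> allowed P i l r p) ->
  in_image P (F, Q).
Proof.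
move=> sFQ [labQ decQ] ok.
have [p Fp] := exists_labelled_by 0 F.
have [q Qq] := exists_labelled_by 0%N Q.
have eS := support_shape sFQ.
pose U := flatten [seq elts J | J <- enum_fset (blocks (support Q))].
have permU : perm_eq U (enum_fset (support Q)) := perm_elts_blocks _.
pose sp := sort (fun x y => q x <= q y)%N U.
have mem_sp k : (k \in sp) = (k \in support F).
  by rewrite mem_sort (perm_mem permU) eS.
have qU : map q U = labels Q.
  rewrite /labels map_flatten -map_comp; congr flatten.
  by apply/eq_in_map => J JQ /=; rewrite Qq.
(* Each label from 1 to the size of the support occurs once, so the entry of index [m] in [sp] has
   label [m + 1]. *)
have qsp : map q sp = iota 1 #|` support Q|.
  apply: (sorted_eq leq_trans anti_leq); last 2 first.
  - exact: iota_sorted.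
  - by apply: perm_trans labQ; rewrite -qU perm_map // perm_sort.
  by rewrite -sort_map sort_sorted //; apply: leq_total.
have ssp : size sp = #|` support Q|.
  by rewrite -(size_map q) qsp size_iota.
have usp : uniq sp by rewrite sort_uniq (perm_uniq permU) fset_uniq.
have q_nth m : (m < size sp)%N -> q (nth 0 sp m) = m.+1.
  by move=> msp; rewrite -(nth_map 0 0%N q msp) qsp nth_iota -?ssp.
have q_index k : k \in support F -> q k = (index k sp).+1.
  rewrite -mem_sp => ksp; rewrite -[in LHS](nth_index 0 ksp) q_nth //.
  by rewrite index_mem.
pose W := map p sp.
have spotsW : spots P W = sp.
  apply: (allowed_spots hbil hloc hmem) => //; first by rewrite size_map.
  move=> m msp; have sF : nth 0 sp m \in support F by rewrite -mem_sp mem_nth.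
  have [l [r [nd ar]]] := node_around sFQ Fp Qq decQ sF.
  exists l, r; split; last by rewrite (nth_map 0) //; apply: ok.
  (* A smaller [q] than that of the entry of index [m] means a place among the first [m] entries of
     [sp]. *)
  apply: eq_around ar => k; rewrite /= mem_takeE mem_sp q_nth //.
  by have [kF|//] := boolP (k \in support F); rewrite /= q_index.
have supW : P W = support Q.
  by apply/fsetP => k; rewrite park_spots spotsW mem_sp eS.
have qE : hatQ P W = Q.
  (* A decreasing tree is determined by its in-order word, and the outcome of each spot is its label
     [q]. *)
  apply: forest_inj => //= I IS; rewrite {1}/tree_on /= in_fnd /= ffunE /=.
  rewrite supW in IS; rewrite -[RHS]dectree_inorder ?decQ // Qq //.
  congr dectree; apply/eq_in_map => k; rewrite mem_sort => kI.
  rewrite /outcome spotsW q_index // eS.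
  have /blocksP[t [u [eI _ [sS _ _]]]] := IS.
  by apply: sS; rewrite -in_itv -eI.
exists W; rewrite /hat /hatP qE; congr pair.
apply: shape_inj => [|I IS].
  by rewrite shape_map_forest sFQ.
rewrite tree_on_map inorder_map_tree Qq // Fp ?eS // -map_comp.
apply/eq_in_map => k; rewrite mem_sort => kI /=.
have kF : k \in support F.
  rewrite eS; have /blocksP[t [u [eI _ [sS _ _]]]] := IS.
  by apply: sS; rewrite -in_itv -eI.
rewrite q_index //= (nth_map 0) ?index_mem ?mem_sp //.
by rewrite nth_index // mem_sp.
Qed.

Theorem proposition5p5 (P : parking_procedure)
    (hbil : bilateral P) (hloc : locally_decided P) (hmem : memoryless P) :
  good_correspondence P /\
  (forall F : forest int,
    (exists Q : forest nat, in_image P (F, Q)) <->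
    (forall (i l r p : int), is_node F i l r p -> allowed P i l r p)).
Proof.
split=> [F Q Q' im decQ' sQ'|F].
  (* The condition on nodes involves [F] alone, so it carries over from [Q] to [Q']. *)
  apply: (allowed_in_image hbil hloc hmem _ decQ'); last first.
    exact: (in_image_allowed hbil hloc hmem im).
  by rewrite sQ'; case: im => W [<- <-]; apply: shape_map_forest.
split=> [[Q im]|ok]; first exact: (in_image_allowed hbil hloc hmem im).
have [Q decQ sQ] := exists_decreasing_forest F.
by exists Q; apply: allowed_in_image.
Qed.
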